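(* Assume that all dependencies are known ($U=\emptyset$) and that the repository, with $n$ packages, contains at most $d$ defects and at most $c$ weak conflicts. There exists an adaptive algorithm that solves Full Learning using $\mathcal S_{n,d+c,1}+\mathcal S_{n,c,2}$ queries.
   Context: A repository consists of a finite set $P$ of $n$ packages, a set $K\subseteq P\times P$ of known dependencies, a set $U\subseteq P\times P$ of unknown dependencies, a set $C$ of unknown conflicts (unordered pairs of distinct packages), and a set $D\subseteq P$ of defects. A pair $(q,p)\in K\cup U$ means that $q$ depends on $p$: any installation including $q$ but not $p$ fails. The digraph $(P,K)$ is acyclic. An installation is a subset $I\subseteq P$; it is successful iff it contains no defect, contains $p$ whenever it contains $q$ with $(q,p)\in K\cup U$, and contains no two packages $p,q$ with $\{p,q\}\in C$. Defects are the packages that cannot be part of any successful installation; thus a package that depends on a defect is itself a defect, i.e. $((P\setminus D)\times D)\cap(K\cup U)=\emptyset$. Given two packages $p,q\in P$, $p$ weakly conflicts with $q$ if no successful installation includes both $p$ and $q$. An algorithm is given $P$, $K$ and the bounds $d,c$. A query is an installation $I\subseteq P$; an oracle answers whether it is successful. An adaptive algorithm asks one query at a time and may choose each query depending on previous answers. The cost is the number of queries. Full Learning: return the mixed graph whose vertices are the strongly connected components of the packages with the defective packages marked, together with all conflicts (here understood as weak conflicts) and all dependencies. With all dependencies known, this amounts to determining the defects and the pairs of packages that weakly conflict. An $(n,a,b)$-cover-free family (CFF) is a set $\mathcal F\subseteq\{0,1\}^n$ such that for all disjoint $S_1,S_2\subseteq\{1,\dots,n\}$ with $|S_1|=a$,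 $|S_2|=b$ there is $v\in\mathcal F$ whose entries are all $0$ on $S_1$ and all $1$ on $S_2$. $\mathcal S_{n,a,b}$ denotes the minimal size of an $(n,a,b)$-CFF.
   Formalization: The formal theorem additionally assumes d+c+1 ≤ n and c+2 ≤ n; otherwise a cover-free family condition is vacuous, its minimal size is 0, and the claim fails (e.g. n=2, d=c=1). The bound c counts only weak conflicts between non-defective packages, which is more general. *)

(* Defs.v *)
From mathcomp Require Import all_boot.

Set Implicit Arguments.
Unset Strict Implicit.
Unset Printing Implicit Defensive.

Section Repositories.
Variable P : finType.

Definition arc (E : {set P * P}) : rel P := [rel q p | (q, p) \in E].

(* Loops count as cycles. *)
Definition acyclic (E : {set P * P}) : Prop :=
  forall s : seq P, cycle (arc E) s -> s = [::].

(* A pair (q, p) of E means that q depends on p; C consists of unordered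
   pairs, encoded as two-element sets. *)
Definition success (E : {set P * P}) (C : {set {set P}}) (D I : {set P}) :
    bool :=
  [&& [disjoint I & D],
      [forall q, forall p, ((q, p) \in E) ==> (q \in I) ==> (p \in I)]
    & [forall A in C, ~~ (A \subset I)]].

Record repository := Repository {
  known : {set P * P};
  unknown : {set P * P};
  conflicts : {set {set P}};
  defects : {set P};
  known_acyclic : acyclic known;
  conflicts_pairs : forall A, A \in conflicts -> #|A| = 2;
  defects_spec : forall p : P,
    p \in defects <->
    ~ exists2 I : {set P},
        success (known :|: unknown) conflicts defects I & p \in I
}.

Definition successful (R : repository) : {set P} -> bool :=
  success (known R :|: unknown R) (conflicts R) (defects R).

Definition weakly_conflict (R : repository) (p q : P) : bool :=
  [forall I : {set P}, successful R I ==> ~~ ((p \in I) && (q \in I))].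

Definition weak_conflicts (R : repository) : {set {set P}} :=
  [set A | [exists p, exists q,
     [&& p != q, A == [set p; q] & weakly_conflict R p q]]].

(* By definition a defect weakly conflicts with every other package.  The
   bound on the number of weak conflicts counts only the pairs that contain no
   defect, since otherwise a single defect would contribute #|P| - 1 of them. *)
Definition bounded_repository (d c : nat) (R : repository) : Prop :=
  #|defects R| <= d /\
  #|[set A in weak_conflicts R | [disjoint A & defects R]]| <= c.

Record mixed_graph := MixedGraph {
  components : {set {set P}};
  marked : {set P};
  edges : {set {set P}};
  arcs : {set P * P}
}.

Definition strongly_connected (E : {set P * P}) : rel P :=
  [rel p q | connect (arc E) p q && connect (arc E) q p].

Definition full_learning (R : repository) : mixed_graph :=
  let E := known R :|: unknown R in
  MixedGraph (equivalence_partition (strongly_connected E) [set: P])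
             (defects R) (weak_conflicts R) E.

(* An adaptive algorithm is a decision tree; the first subtree of a query is
   taken when the oracle answers that the installation is successful. *)
Inductive algorithm :=
  | Return of mixed_graph
  | Query of {set P} & algorithm & algorithm.

Fixpoint output (oracle : {set P} -> bool) (A : algorithm) : mixed_graph :=
  match A with
  | Return g => g
  | Query Q A1 A0 => output oracle (if oracle Q then A1 else A0)
  end.

Fixpoint cost (oracle : {set P} -> bool) (A : algorithm) : nat :=
  match A with
  | Return _ => 0
  | Query Q A1 A0 => (cost oracle (if oracle Q then A1 else A0)).+1
  end.

End Repositories.

(* The algorithm is a function of its input: P, K, d and c. *)
Definition adaptive_algorithm : Type :=
  forall P : finType, {set P * P} -> nat -> nat -> algorithm P.

Definition is_cff (n a b : nat) (F : {set {ffun 'I_n -> bool}}) : bool :=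
  [forall S1 : {set 'I_n}, forall S2 : {set 'I_n},
    [&& [disjoint S1 & S2], #|S1| == a & #|S2| == b] ==>
    [exists v in F, [forall i in S1, ~~ v i] && [forall i in S2, v i]]].

(* The whole cube is a cover-free family, so the minimum exists. *)
Definition cff_size (n a b : nat) : nat :=
  #|[arg min_(F < [set: {ffun 'I_n -> bool}] | is_cff a b F) #|F|]|.

Lemma is_cff_setT (n a b : nat) : is_cff a b [set: {ffun 'I_n -> bool}].
Proof.
apply/forallP => S1; apply/forallP => S2; apply/implyP => /and3P[dS _ _].
apply/existsP; exists [ffun i => i \in S2]; rewrite inE /=.
apply/andP; split; apply/forallP => i; apply/implyP; rewrite ffunE //.
by move=> iS1; rewrite (disjointFr dS iS1).
Qed.

Lemma cff_size_min (n a b : nat) :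
  (exists2 F : {set {ffun 'I_n -> bool}}, is_cff a b F & #|F| = cff_size n a b)
  /\ (forall F : {set {ffun 'I_n -> bool}},
        is_cff a b F -> cff_size n a b <= #|F|).
Proof.
rewrite /cff_size; case: arg_minnP; first exact: is_cff_setT.
by move=> F cF minF; split; first exists F.
Qed.

(* Main.v *)
(* Installing a set V together with everything it depends on succeeds exactly
   when V contains no defect and no weakly conflicting pair.  To detect that a
   set T of packages can be installed together, it therefore suffices that the
   zeros of some member of the cover-free family contain all defects not yet
   discarded and one package outside T from each weak conflict, while its ones
   contain T.  With T a singleton this finds the defects, using d + c zeros;
   with these discarded and T a pair, it finds the weak conflicts, using c
   zeros. *)
Require Import Defs.
From mathcomp Require Import all_boot.

Set Implicit Arguments.
Unset Strict Implicit.
Unset Printing Implicit Defensive.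

(** * Padding a set, and hitting a family of sets *)

Section FiniteSets.
Variable T : finType.
Implicit Types A B S : {set T}.

(** Pads a set whose size is only bounded to the exact size that [is_cff] asks for. *)
Lemma subset_interpolate A B (n : nat) :
  A \subset B -> #|A| <= n <= #|B| ->
  exists2 S : {set T}, A \subset S & (S \subset B) && (#|S| == n).
Proof.
move=> sAB /andP[leAn]; rewrite -(subnKC leAn).
elim: (n - #|A|) => [|m IHm] ltB; first by exists A; rewrite // sAB addn0 eqxx.
rewrite addnS in ltB *.
have [S sAS /andP[sSB /eqP cS]] := IHm (ltnW ltB).
have [x xB xS] : exists2 x, x \in B & x \notin S.
  by apply/subsetPn/negP => /subset_leq_card; rewrite leqNgt cS ltB.
exists (x |: S); first by rewrite (subset_trans sAS) ?subsetUr.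
by rewrite subUset sub1set xB sSB cardsU1 xS cS add1n eqxx.
Qed.

(** Pick one element outside [A] from each member of [W]; picks may coincide, hence only an upper
    bound on the size. *)
Lemma hitting_set (W : {set {set T}}) A :
  (forall w, w \in W -> ~~ (w \subset A)) ->
  exists S : {set T}, [/\ [disjoint S & A], #|S| <= #|W|
    & forall w, w \in W -> ~~ [disjoint w & S]].
Proof.
(* [T] may be empty, so the default value [x0] of the choice function has to come from a member of
   [W]. *)
move=> hW; have [-> | [w0 /hW/subsetPn[x0 _ _]]] := set_0Vmem W.
  exists set0; rewrite cards0 disjoints_subset sub0set.
  by split=> // w; rewrite inE.
pose f (w : {set T}) := odflt x0 [pick x in w :\: A].
have fP w : w \in W -> f w \in w :\: A.
  move=> /hW/subsetPn[x xw xA]; rewrite /f; case: pickP => //= /(_ x).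
  by rewrite inE xw xA.
exists (f @: W); split; last 1 first.
- move=> w wW; apply/pred0Pn; exists (f w) => /=; rewrite imset_f // andbT.
  by have := fP w wW; rewrite inE => /andP[].
- rewrite disjoint_subset; apply/subsetP => _ /imsetP[w /fP + ->].
  by rewrite !inE => /andP[].
- exact: leq_imset_card.
Qed.

End FiniteSets.

(** * Query batches obtained from cover-free families *)

Section Queries.
Variable P : finType.
Implicit Types (E : {set P * P}) (R : repository P) (V I A T X : {set P}).

Definition dependency_closure E V : {set P} :=
  [set p | [exists v in V, connect (Defs.arc E) v p]].

Definition positives (v : {ffun 'I_#|P| -> bool}) : {set P} :=
  [set p | v (enum_rank p)].

(** [A] is first enlarged to exactly [a] elements inside the complement of [T]; [a + b <= #|P|]
    leaves room for this. *)
Lemma cff_separates (a b : nat) (F : {set {ffun 'I_#|P| -> bool}}) A T :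
  is_cff a b F -> a + b <= #|P| -> [disjoint A & T] -> #|A| <= a ->
  #|T| = b ->
  exists2 v, v \in F & [disjoint A & positives v] && (T \subset positives v).
Proof.
move=> cF leP dAT leA cT.
have sA : A \subset ~: T by rewrite -disjoints_subset.
have leC : #|A| <= a <= #|~: T|.
  by rewrite leA -(leq_add2r b) -{2}cT [leqRHS]addnC cardsC.
have [S sAS /andP[sST /eqP cS]] := subset_interpolate sA leC.
have /implyP cover := forallP (forallP cF (enum_rank @: S)) (enum_rank @: T).
have [|v /and3P[vF /forallP v0 /forallP v1]] := existsP (cover _).
  rewrite !card_imset ?cS ?cT ?eqxx; try exact: enum_rank_inj.
  rewrite !andbT disjoint_subset; apply/subsetP => _ /imsetP[x xS ->].
  rewrite !inE mem_imset; last exact: enum_rank_inj.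
  by have := subsetP sST x xS; rewrite inE.
exists v => //; apply/andP; split.
  rewrite disjoint_subset; apply/subsetP => x xA; rewrite !inE.
  by apply: (implyP (v0 (enum_rank x))); rewrite imset_f // (subsetP sAS).
apply/subsetP => x xT; rewrite inE.
by apply: (implyP (v1 (enum_rank x))); rewrite imset_f.
Qed.

(** [X] holds the packages discarded in advance: none in the first round, the defects found in the
    second. *)
Definition queries E (F : {set {ffun 'I_#|P| -> bool}}) X : seq {set P} :=
  [seq dependency_closure E (positives v :\: X) | v <- enum F].

Lemma size_queries E F X : size (queries E F X) = #|F|.
Proof. by rewrite size_map cardE. Qed.

(** A nonadaptive batch as a decision tree; the continuation receives the successful queries, so
    that a later batch can depend on them. *)
Fixpoint ask (qs : seq {set P}) (k : seq {set P} -> algorithm P) :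
    algorithm P :=
  if qs is Q :: qs' then Query Q (ask qs' (fun s => k (Q :: s))) (ask qs' k)
  else k [::].

Lemma output_ask oracle qs k :
  output oracle (ask qs k) = output oracle (k (filter oracle qs)).
Proof. by elim: qs k => //= Q qs IHqs k; case: ifP => _; rewrite IHqs. Qed.

Lemma cost_ask oracle qs k :
  cost oracle (ask qs k) = size qs + cost oracle (k (filter oracle qs)).
Proof. by elim: qs k => //= Q qs IHqs k; case: ifP => _; rewrite IHqs. Qed.

(** * Successful installations and weak conflicts *)

Lemma successful_disjoint R I p :
  successful R I -> p \in I -> p \notin defects R.
Proof. by case/and3P=> dI _ _ /(disjointFr dI)->. Qed.

Lemma nondefect_installable R p :
  p \notin defects R -> exists2 I, successful R I & p \in I.
Proof.
(* [defects_spec] yields only a double negation, removed by deciding the existence over the finitely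
   many installations. *)
move=> pD; have [/exists_inP[I ? ?] | nI] :=
  boolP [exists I in successful R, p \in I]; first by exists I.
case/negP: pD; apply/defects_spec => -[I sI pI].
by case/exists_inP: nI; exists I.
Qed.

Lemma successful_connect R I p q :
  successful R I -> p \in I -> connect (Defs.arc (known R :|: unknown R)) p q ->
  q \in I.
Proof.
case/and3P=> _ /forallP cI _ + /connectP[s + ->].
elim: s p => //= r s IHs p pI /andP[pr]; apply: IHs.
by move/forallP: (cI p) => /(_ r) /implyP/(_ pr) /implyP; apply.
Qed.

Lemma not_weakly_conflictP R p q :
  reflect (exists2 I, successful R I & [set p; q] \subset I)
          (~~ weakly_conflict R p q).
Proof.
rewrite negb_forall; apply: (iffP existsP) => [[I] | [I sI pqI]].
  rewrite negb_imply negbK => /andP[sI pqI].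
  by exists I; rewrite // subUset !sub1set.
by exists I; rewrite sI negbK -!sub1set -subUset.
Qed.

Lemma weak_conflicts_not_subset R A I :
  successful R I -> A \in weak_conflicts R -> ~~ (A \subset I).
Proof.
move=> sI; rewrite inE => /existsP[p /existsP[q /and3P[_ /eqP-> wpq]]].
by apply: contraL wpq => pqI; apply/not_weakly_conflictP; exists I.
Qed.

(** Any fault in the closure traces back to [V] along dependency paths: a package that reaches a
    defect is a defect, and two packages that reach the two sides of a conflict weakly conflict. *)
Lemma successful_closure R V :
  [disjoint V & defects R] ->
  (forall A, A \in weak_conflicts R -> [disjoint A & defects R] ->
     ~~ (A \subset V)) ->
  successful R (dependency_closure (known R :|: unknown R) V).
Proof.
move=> dV wV; apply/and3P; split.
- rewrite disjoint_subset; apply/subsetP => p; rewrite !inE.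
  case/exists_inP=> v vV vp.
  have [I sI vI] := nondefect_installable (negbT (disjointFr dV vV)).
  exact: successful_disjoint sI (successful_connect sI vI vp).
- apply/forallP => p; apply/forallP => q; apply/implyP => pq; apply/implyP.
  rewrite !inE => /exists_inP[v vV vp]; apply/exists_inP; exists v => //.
  exact: connect_trans vp (connect1 pq).
- apply/forall_inP => A AC; apply/negP => sA.
  have /eqP/cards2P[x [y [_ defA]]] := conflicts_pairs AC.
  move: sA; rewrite defA subUset !sub1set !inE.
  case/andP=> /exists_inP[x' x'V x'x] /exists_inP[y' y'V y'y].
  have wc : weakly_conflict R x' y'.
    rewrite -[weakly_conflict _ _ _]negbK.
    apply/not_weakly_conflictP => -[I sI]; rewrite subUset !sub1set.
    case/andP=> x'I y'I; have /and3P[_ _ /forall_inP/(_ A AC)/negP[]] := sI.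
    rewrite defA subUset !sub1set.
    by rewrite (successful_connect sI x'I) ?(successful_connect sI y'I).
  have x'D := negbT (disjointFr dV x'V).
  (* If one package reaches both sides of the conflict, there is no pair in [weak_conflicts] to
     invoke; instead that package would be uninstallable, hence a defect. *)
  have [eq_xy | ne_xy] := eqVneq x' y'.
    have [I sI x'I] := nondefect_installable x'D.
    move: wc; rewrite -eq_xy; apply/negP/not_weakly_conflictP; exists I => //.
    by rewrite subUset !sub1set x'I.
  have /wV: [set x'; y'] \in weak_conflicts R.
    rewrite inE; apply/existsP; exists x'; apply/existsP; exists y'.
    by rewrite ne_xy eqxx.
  have s2V : [set x'; y'] \subset V by rewrite subUset !sub1set x'V.
  by rewrite s2V (disjointWl s2V dV) => /(_ isT).
Qed.

(** Stated for general [X] and [T] so as to serve both rounds. Since [I] is successful, no weak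
    conflict lies inside [T], so the hitting set can avoid [T]. *)
Lemma queries_cover R (a b : nat) (F : {set {ffun 'I_#|P| -> bool}}) X T I :
  is_cff a b F -> a + b <= #|P| -> X \subset defects R ->
  #|defects R :\: X|
    + #|[set A in weak_conflicts R | [disjoint A & defects R]]| <= a ->
  successful R I -> T \subset I -> #|T| = b ->
  exists2 Q, Q \in filter (successful R) (queries (known R :|: unknown R) F X)
    & T \subset Q.
Proof.
set W := finset _ => cF leP sXD leD sI sTI cT.
have dID : [disjoint I & defects R] by case/and3P: sI.
have [|S [dST leS hitS]] := @hitting_set P W T.
  move=> w; rewrite inE => /andP[/(weak_conflicts_not_subset sI) + _].
  by apply: contra => /subset_trans; apply.
pose Z := (defects R :\: X) :|: S.
have dZT : [disjoint Z & T].
  rewrite disjoints_subset subUset -!disjoints_subset dST andbT.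
  apply: disjointWl (subsetDl _ _) _.
  by rewrite disjoint_sym (disjointWl sTI).
have leZ : #|Z| <= a.
  by rewrite (leq_trans _ leD) // (leq_trans (leq_card_setU _ _).1) ?leq_add2l.
have [v vF /andP[dZv sTv]] := cff_separates cF leP dZT leZ cT.
pose V := positives v :\: X.
(* Discarding [X] loses nothing of [T]: [X] consists of defects, and [I] contains none. *)
have sTV : T \subset V.
  by rewrite subsetD sTv (disjointWl sTI) // (disjointWr sXD).
exists (dependency_closure (known R :|: unknown R) V); last first.
  apply: subset_trans sTV _; apply/subsetP => p pV; rewrite inE.
  by apply/exists_inP; exists p.
rewrite mem_filter andbC; apply/andP; split.
  by apply/mapP; exists v; rewrite ?mem_enum.
apply: successful_closure.
  rewrite disjoint_subset; apply/subsetP => p; rewrite !inE => /andP[pX pv].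
  apply/negP => pD; have := disjointFl dZv (x := p).
  by rewrite !inE pD pX pv => /(_ isT).
move=> A Aw AD; have AW : A \in W by rewrite inE Aw.
have /pred0Pn[x /andP[/= xA xS]] := hitS A AW.
apply/subsetPn; exists x => //; rewrite !inE negb_and negbK; apply/orP; right.
by have := disjointFr dZv (x := x); rewrite !inE xS orbT => /(_ isT)->.
Qed.

(** * The two-round learner, its cost and its correctness *)

Definition minimum_cff (n a b : nat) : {set {ffun 'I_n -> bool}} :=
  [arg min_(F < [set: {ffun 'I_n -> bool}] | is_cff a b F) #|F|].

Lemma minimum_cffP (n a b : nat) : is_cff a b (minimum_cff n a b).
Proof. by rewrite /minimum_cff; case: arg_minnP; first exact: is_cff_setT. Qed.

Definition uncovered (s : seq {set P}) : {set P} :=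
  [set p | ~~ has (fun I => p \in I) s].

(** Shaped like [weak_conflicts], so that the two can be compared under the quantifiers, one pair at
    a time. *)
Definition uncovered_pairs (s : seq {set P}) : {set {set P}} :=
  [set A | [exists p, exists q,
     [&& p != q, A == [set p; q] & ~~ has (fun I => [set p; q] \subset I) s]]].

Definition full_learner (K : {set P * P}) (d c : nat) : algorithm P :=
  ask (queries K (minimum_cff #|P| (d + c) 1) set0) (fun s1 =>
  ask (queries K (minimum_cff #|P| c 2) (uncovered s1)) (fun s2 =>
  Return (MixedGraph
    (equivalence_partition (strongly_connected K) [set: P])
    (uncovered s1) (uncovered_pairs s2) K))).

Lemma cost_full_learner oracle K d c :
  cost oracle (full_learner K d c)
    = cff_size #|P| (d + c) 1 + cff_size #|P| c 2.
(* The cardinal of [minimum_cff] is [cff_size] by conversion. *)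
Proof. by rewrite !cost_ask !size_queries addn0. Qed.

Lemma uncovered_defects R d c :
  (d + c) + 1 <= #|P| -> bounded_repository d c R ->
  uncovered (filter (successful R) (queries (known R :|: unknown R)
    (minimum_cff #|P| (d + c) 1) set0)) = defects R.
Proof.
move=> leP [leD leC]; apply/setP => p; rewrite inE.
have [pD | pD] := boolP (p \in defects R).
  apply/hasPn => I; rewrite mem_filter => /andP[sI _].
  by apply: contraL pD; apply: successful_disjoint.
have [I sI] := nondefect_installable pD; rewrite -sub1set => pI.
have [|Q Qs] := queries_cover (minimum_cffP _ _ _) leP (sub0set _) _ sI pI
  (cards1 p); first by rewrite setD0 leq_add.
by rewrite sub1set => pQ; apply/negbTE; rewrite negbK; apply/hasP; exists Q.
Qed.

(** Pairs containing a defect are outside the bound [c] but come out as well, since no successful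
    query covers them. With all defects discarded, [c] zeros are enough. *)
Lemma uncovered_pairs_weak_conflicts R d c :
  c + 2 <= #|P| -> bounded_repository d c R ->
  uncovered_pairs (filter (successful R) (queries (known R :|: unknown R)
    (minimum_cff #|P| c 2) (defects R))) = weak_conflicts R.
Proof.
move=> leP [_ leC]; apply/setP => A; rewrite !inE.
apply: eq_existsb => p; apply: eq_existsb => q; have [//|pq /=] := eqVneq p q.
congr (_ && _); apply/idP/idP.
  apply: contraR => /not_weakly_conflictP[I sI pqI].
  have c2 : #|[set p; q]| = 2 by rewrite cards2 pq.
  have [|Q Qs pqQ] := queries_cover (minimum_cffP _ _ _) leP (subxx _) _ sI pqI
    c2; first by rewrite setDv cards0.
  by apply/hasP; exists Q.
apply: contraL => /hasP[I]; rewrite mem_filter => /andP[sI _] pqI.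
by apply/not_weakly_conflictP; exists I.
Qed.

End Queries.

Theorem theorem10 :
  exists Alg : adaptive_algorithm,
  forall (P : finType) (K : {set P * P}) (d c : nat),
    (d + c) + 1 <= #|P| -> c + 2 <= #|P| ->
    forall R : repository P,
      known R = K -> unknown R = set0 -> bounded_repository d c R ->
      output (successful R) (Alg P K d c) = full_learning R /\
      cost (successful R) (Alg P K d c)
        <= cff_size #|P| (d + c) 1 + cff_size #|P| c 2.
Proof.
exists full_learner => P K d c le1 le2 R defK R0 bR.
split; last by rewrite cost_full_learner.
have -> : K = known R :|: unknown R by rewrite R0 setU0.
rewrite !output_ask (uncovered_defects le1 bR).
by rewrite (uncovered_pairs_weak_conflicts le2 bR).
Qed.
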